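(* Let $R$ be a $W\sqrt{J}U$ ring with $\operatorname{char}(R)>0$. Then $\operatorname{char}(R)=2^{\alpha}3^{\beta}$ for some $\alpha,\beta\in\mathbb{N}\cup\{0\}$.
   Context: Rings are associative with identity, not necessarily commutative. For a ring $A$, $U(A)$ is its group of units, $J(A)$ its Jacobson radical, and $\sqrt{J(A)}=\{x\in A : x^n\in J(A)\text{ for some } n\ge 1\}$. A ring $A$ is $W\sqrt{J}U$ (weakly $\sqrt{J}U$) if $U(A)=\pm 1+\sqrt{J(A)}$; equivalently, every unit of $A$ can be written as $j+1$ or as $j-1$ for some $j\in\sqrt{J(A)}$. *)

(* Defs.v *)
From mathcomp Require Import all_boot all_order all_algebra.
From mathcomp Require Import boolp classical_sets.

Set Implicit Arguments.
Unset Strict Implicit.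
Unset Printing Implicit Defensive.

Import GRing.Theory.
Local Open Scope classical_set_scope.
Local Open Scope ring_scope.

(* Rings are [pzRingType]s: associative with identity, not assumed commutative,
   the zero ring allowed. Units are defined by two-sided inverses because
   [unitRingType] would exclude the zero ring. *)
Definition units (R : pzRingType) : set R :=
  [set u | exists v : R, u * v = 1 /\ v * u = 1].
Arguments units : clear implicits.

Definition left_ideal (R : pzRingType) (I : set R) : Prop :=
  [/\ I 0, forall x y, I x -> I y -> I (x + y) & forall a x, I x -> I (a * x)].

Definition maximal_left_ideal (R : pzRingType) (M : set R) : Prop :=
  [/\ left_ideal M, M <> setT &
      forall K : set R, left_ideal K -> M `<=` K -> K = M \/ K = setT].

(* If R is the zero ring there is no maximal left ideal and J(R) = R. *)
Definition jacobson (R : pzRingType) : set R :=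
  \bigcap_(M in [set M : set R | maximal_left_ideal M]) M.
Arguments jacobson : clear implicits.

Definition sqrt_jacobson (R : pzRingType) : set R :=
  [set x | exists n : nat, (0 < n)%N /\ jacobson R (x ^+ n)].
Arguments sqrt_jacobson : clear implicits.

Definition WsqrtJU (R : pzRingType) : Prop :=
  units R = [set 1 + j | j in sqrt_jacobson R]
        `|` [set -1 + j | j in sqrt_jacobson R].

(* The least n > 0 with n 1 = 0 in R, and 0 if there is none. MathComp's
   [pchar R] is the set of primes vanishing in R, hence not usable here. *)
Definition ring_char (R : pzRingType) : nat :=
  match pselect (exists n : nat, (0 < n)%N && (n%:R == 0 :> R)) with
  | left exn => ex_minn exn
  | right _ => 0%N
  end.

(* Main.v *)
Require Import Defs.
From mathcomp Require Import all_boot all_order all_algebra.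
From mathcomp Require Import boolp classical_sets.

(** Write n for the characteristic and suppose that a prime p > 3 divides n.
    By the Chinese remainder theorem there is an integer u congruent to 2
    modulo p and to 1 modulo the prime-to-p part of n. It is coprime to n, so
    its image in R is a unit ([coprime_char_units]), and the hypothesis puts
    u - 1 or u + 1 in the square root of J(R). Modulo p these integers are 1
    and 3, which are not divisible by p.

    On the other hand an integer that is nilpotent modulo J(R) is divisible by
    every prime divisor p of n ([dvdn_sqrt_jacobson]). Indeed p is a zero
    divisor, being killed by n/p, so Rp is a proper left ideal and Krull's
    theorem ([maximal_left_ideal_exists]) puts it in a maximal left ideal. That
    ideal contains both p and every integer of J(R), and two coprime integers
    cannot both lie in it.

    Hence only 2 and 3 can divide n. *)

Set Implicit Arguments.
Unset Strict Implicit.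
Unset Printing Implicit Defensive.

Import GRing.Theory.
Local Open Scope classical_set_scope.
Local Open Scope ring_scope.

Lemma left_ideal_eqT (R : pzRingType) (I : set R) :
  left_ideal I -> I 1 -> I = setT.
Proof.
move=> [_ _ IM] I1; apply/seteqP; split=> // x _.
by rewrite -(mulr1 x); exact: IM.
Qed.

(** Krull's theorem, by Zorn's lemma on the proper left ideals containing [I]. *)
Lemma maximal_left_ideal_exists (R : pzRingType) (I : set R) :
  left_ideal I -> ~ I 1 ->
  exists2 M : set R, maximal_left_ideal M & I `<=` M.
Proof.
move=> idI I1.
(* The union of the empty chain is empty, hence not an ideal: ordering the sets
   X such that I `|` X is a proper ideal makes that union correspond to I. *)
pose P := [set X : set R | left_ideal (I `|` X) /\ ~ (I `|` X) 1].
have [A [[idA A1] Amax]] : exists A, P A /\ forall B, A `<` B -> ~ P B.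
  apply: Zorn_bigcup => F FP Ftot; split; last first.
    by case=> [//|[X FX X1]]; apply: (FP X FX).2; right.
  have [I0 ID IM] := idI.
  have FD X x y : F X -> (I `|` X) x -> (I `|` X) y ->
      (I `|` \bigcup_(Y in F) Y) (x + y).
    move=> FX Xx Xy; have [_ XD _] := (FP X FX).1.
    by case: (XD x y Xx Xy) => [|Xxy]; [left | right; exists X].
  split.
  - by left.
  - move=> x y [Ix|[X FX Xx]] [Iy|[Y FY Yy]].
    + by left; exact: ID.
    + by apply: (FD Y) => //; [left | right].
    + by apply: (FD X) => //; [right | left].
    + case: (Ftot X Y FX FY) => sub.
        by apply: (FD Y) => //; right=> //; exact: sub.
      by apply: (FD X) => //; right=> //; exact: sub.
  - move=> a x [Ix|[X FX Xx]]; first by left; exact: IM.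
    have [_ _ XM] := (FP X FX).1.
    by case: (XM a x (or_intror Xx)) => [|Xax]; [left | right; exists X].
exists (I `|` A); last by move=> x; left.
split=> //; first by move=> IAT; apply: A1; rewrite IAT.
move=> K idK sIAK.
have [K1|K1] := pselect (K 1); first by right; exact: left_ideal_eqT.
left; apply/seteqP; split=> // x Kx.
have sIK : I `|` K = K by apply/setUidPr => y Iy; apply: (sIAK y); left.
apply: contrapT => nx; apply: (Amax K); last by split; rewrite sIK.
split; first by move=> y Ay; apply: (sIAK y); right.
by move=> sKA; apply: nx; right; exact: sKA.
Qed.

Lemma left_ideal_principal (R : pzRingType) (x : R) :
  left_ideal [set a * x | a in setT].
Proof.
split.
- by exists 0; rewrite ?mul0r.
- by move=> _ _ [a _ <-] [b _ <-]; exists (a + b); rewrite ?mulrDl.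
- by move=> a _ [b _ <-]; exists (a * b); rewrite ?mulrA.
Qed.

Lemma left_ideal_coprime (R : pzRingType) (I : set R) (a b : nat) :
  left_ideal I -> (0 < b)%N -> coprime a b -> I a%:R -> I b%:R -> I 1.
Proof.
move=> [_ ID IM] b_gt0 /eqP co Ia Ib.
have [k _ /dvdnP[l]] := Bezoutr a b_gt0; rewrite co => El.
have -> : 1 = l%:R * b%:R + - k%:R * a%:R :> R.
  by rewrite mulNr -!natrM -El natrD addrK.
by apply: ID; exact: IM.
Qed.

Lemma natr_ring_char (R : pzRingType) : (ring_char R)%:R = 0 :> R.
Proof.
rewrite /ring_char; case: pselect => // ex.
by case: ex_minnP => n /andP[_ /eqP].
Qed.

Lemma ring_char_min (R : pzRingType) (m : nat) :
  (0 < m)%N -> m%:R = 0 :> R -> (ring_char R <= m)%N.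
Proof.
move=> m_gt0 m0; rewrite /ring_char; case: pselect => // ex.
by case: ex_minnP => n _; apply; rewrite m_gt0 m0 eqxx.
Qed.

(** Bezout gives k u = -1 modulo n, whence the sign in the inverse. *)
Lemma coprime_char_units (R : pzRingType) (u : nat) :
  (0 < ring_char R)%N -> coprime u (ring_char R) -> units R u%:R.
Proof.
move=> n_gt0 /eqP co; have [k _ /dvdnP[l]] := Bezoutr u n_gt0; rewrite co => El.
have ku : k%:R * u%:R = - 1 :> R.
  apply/eqP; rewrite -addr_eq0 addrC -natrM -[1]/(1%:R) -natrD El.
  by rewrite natrM natr_ring_char mulr0.
by exists (- k%:R); rewrite mulrN mulNr -natrM mulnC natrM ku opprK.
Qed.

(** A left inverse of [p] in [R] would make n/p vanish, against the minimality
    of the characteristic n. *)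
Lemma char_divisor_proper (R : pzRingType) (p : nat) :
  (0 < ring_char R)%N -> (1 < p)%N -> (p %| ring_char R)%N ->
  ~ [set a * p%:R | a in setT] (1 : R).
Proof.
move=> n_gt0 p_gt1 /dvdnP[m nE] [a _ ap1].
have m_gt0 : (0 < m)%N by move: n_gt0; rewrite nE muln_gt0 => /andP[].
have m0 : m%:R = 0 :> R.
  have : a * p%:R * m%:R = 0.
    by rewrite -mulrA -natrM mulnC -nE natr_ring_char mulr0.
  by rewrite ap1 mul1r.
have := ring_char_min m_gt0 m0.
by rewrite nE leqNgt ltn_Pmulr.
Qed.

(** A maximal left ideal above Rp contains [p] and [c], which therefore cannot
    be coprime. *)
Lemma dvdn_jacobson (R : pzRingType) (p c : nat) :
  (0 < ring_char R)%N -> prime p -> (p %| ring_char R)%N ->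
  jacobson R c%:R -> (p %| c)%N.
Proof.
move=> n_gt0 p_pr pn Jc; apply/negPn/negP => pNc.
have [M Mmax pM] := maximal_left_ideal_exists (left_ideal_principal p%:R)
  (char_divisor_proper n_gt0 (prime_gt1 p_pr) pn).
have [idM MT _] := Mmax; apply/MT/left_ideal_eqT => //.
apply: (left_ideal_coprime idM (prime_gt0 p_pr) (a := c)).
- by rewrite coprime_sym prime_coprime.
- exact: Jc.
- by apply: pM; exists 1; rewrite ?mul1r.
Qed.

Lemma dvdn_sqrt_jacobson (R : pzRingType) (p c : nat) :
  (0 < ring_char R)%N -> prime p -> (p %| ring_char R)%N ->
  sqrt_jacobson R c%:R -> (p %| c)%N.
Proof.
move=> n_gt0 p_pr pn [e [e_gt0]]; rewrite -natrX.
by move=> /(dvdn_jacobson n_gt0 p_pr pn); rewrite Euclid_dvdX // => /andP[].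
Qed.

(** The integer 2 need not be a unit of [R], as n may be even; the Chinese
    remainder theorem replaces it by a unit congruent to 2 modulo [p]. *)
Lemma WsqrtJU_char_prime (R : pzRingType) (p : nat) :
  WsqrtJU R -> (0 < ring_char R)%N -> prime p -> (p %| ring_char R)%N ->
  (p <= 3)%N.
Proof.
move=> hR n_gt0 p_pr pn; rewrite leqNgt; apply/negP => p_gt3.
set n := ring_char R in n_gt0 pn; pose m := (n`_p^')%N.
have co_pm : coprime p m by rewrite prime_coprime // -p'natE // part_pnat.
pose u := chinese p m 2 1.
have u_p : u = 2 %[mod p] := chinese_modl co_pm 2 1.
have u_m : u = 1 %[mod m] := chinese_modr co_pm 2 1.
have co_un : coprime u n.
  rewrite -(partnC p n_gt0) coprimeMr; apply/andP; split.
    have [k ->] := p_natP (part_pnat p n); apply: coprimeXr.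
    rewrite -coprime_modl u_p coprime_modl coprime_sym prime_coprime //.
    by rewrite gtnNdvd // ltnW.
  by rewrite -coprime_modl u_m coprime_modl coprime1n.
have p_dvd c : sqrt_jacobson R c%:R -> (p %| c)%N.
  exact: (@dvdn_sqrt_jacobson R).
have u_gt0 : (0 < u)%N.
  rewrite lt0n; apply/eqP => u0; move: u_p.
  by rewrite u0 mod0n modn_small // ltnW.
have : units R u%:R by exact: coprime_char_units.
rewrite hR => -[] [j Jj ju].
(* u = 1 + j puts u - 1 in the root of J(R), but u - 1 is 1 modulo p. *)
- have : (p %| u.-1)%N.
    apply: p_dvd; suff -> : u.-1%:R = j by [].
    by apply: (addrI 1); rewrite ju nat1r prednK.
  have -> : (p %| u.-1)%N = (u == 1 %[mod p]) by rewrite eqn_mod_dvd // subn1.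
  by rewrite u_p !modn_small //; apply: leq_trans p_gt3.
(* u = -1 + j puts u + 1 there, but u + 1 is 3 modulo p, and p > 3. *)
- have : (p %| u + 1)%N.
    by apply: p_dvd; rewrite natrD -ju addrAC addNr add0r.
  rewrite /dvdn -modnDml u_p modnDml.
  by rewrite modn_small.
Qed.

Theorem lemma2p16 (R : pzRingType) (hR : WsqrtJU R) (hchar : (0 < ring_char R)%N) :
  exists alpha beta : nat, ring_char R = (2 ^ alpha * 3 ^ beta)%N.
Proof.
set n := ring_char R in hchar *.
have [a Ea] := p_natP (part_pnat 2%N n).
have n3 : (3.-nat n`_2^')%N.
  apply/pnatP=> [|p p_pr pn']; first exact: part_gt0.
  have p_le3 : (p <= 3)%N.
    apply: (WsqrtJU_char_prime hR) => //; exact: dvdn_trans pn' (dvdn_part _ _).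
  have /pnatP p_ne2 := part_pnat 2%N^' n.
  have := p_ne2 (part_gt0 _ _) p p_pr pn'.
  by case: p p_le3 p_pr {pn'} => [|[|[|[|]]]].
have [b Eb] := p_natP n3.
by exists a, b; rewrite -Ea -Eb partnC.
Qed.
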